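(* Let $K$ be a field of characteristic zero which is algebraically closed in a field $L\supseteq K$, let $x=(x_1,\dots,x_n)$ and $H\in L[x]^m$ with $\operatorname{trdeg}_K K(H)\le\operatorname{trdeg}_L L(H)$. Let $\tilde L$ be an extension field of $L$ and let $p\in\tilde L^m$ be a projective image apex of $H$ over $K$. Write $p=\lambda_1p^{(1)}+\cdots+\lambda_rp^{(r)}$ with $p^{(i)}\in K^m$ and $\lambda_1,\dots,\lambda_r\in\tilde L$ linearly independent over $K$. Then for each $i$, $p^{(i)}$ is either zero or a projective image apex of $H$ over $\tilde L$.
   Context: With $y=(y_1,\dots,y_m)$, a new indeterminate $t$ and a field $F\supseteq K$: a vector $p$ with entries in an extension field of $L$ containing $F$ is a projective image apex of $H$ over $F$ if $p\ne0$ and for every $f\in F[y]$, $f(H)=0$ implies $f(H+tp)=0$. $F(H)$ is the field generated over $F$ by the components of $H$, $\operatorname{trdeg}$ its transcendence degree. *)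

(* Defs.v *)
From HB Require Import structures.
From mathcomp Require Import all_boot all_order all_algebra fraction.
From mathcomp Require Import mpoly.
Set Implicit Arguments. Unset Strict Implicit. Unset Printing Implicit Defensive.
Import GRing.Theory.
Local Open Scope ring_scope.

Notation ratfun E n := {fraction {mpoly E[n]}}.

Definition alg_closed_in (K L : fieldType) (iK : {rmorphism K -> L}) : Prop :=
  forall a : L, (exists2 q : {poly K}, q != 0 & root (map_poly iK q) a) ->
  exists c : K, a = iK c.

Definition alg_indep (F E : fieldType) (k : nat) (phi : F -> E) (z : 'I_k -> E) : Prop :=
  forall f : {mpoly F[k]}, mmap phi z f = 0 -> f = 0.

Definition in_gen_field (F E : fieldType) (m : nat) (phi : F -> E) (z : 'I_m -> E)
  (w : E) : Prop :=
  exists f g : {mpoly F[m]},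
    mmap phi z g != 0 /\ w = mmap phi z f / mmap phi z g.

Definition trdeg_ge (F E : fieldType) (m : nat) (phi : F -> E) (z : 'I_m -> E)
  (k : nat) : Prop :=
  exists w : 'I_k -> E, (forall i, in_gen_field phi z (w i)) /\ alg_indep phi w.

Definition trdeg_le (F1 E1 F2 E2 : fieldType) (m1 m2 : nat)
  (phi1 : F1 -> E1) (z1 : 'I_m1 -> E1) (phi2 : F2 -> E2) (z2 : 'I_m2 -> E2) : Prop :=
  forall k, trdeg_ge phi1 z1 k -> trdeg_ge phi2 z2 k.

Definition proj_apex (F E : fieldType) (n m : nat) (phi : F -> E)
  (H : 'I_m -> {mpoly E[n]}) (p : 'I_m -> E) : Prop :=
  (exists i, p i != 0) /\
  forall f : {mpoly F[m]},
    mmap (fun c => (phi c)%:MP) H f = 0 ->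
    mmap (fun c => ((phi c)%:MP)%:P) (fun i => (H i)%:P + 'X * ((p i)%:MP)%:P) f = 0.

(* Main.v *)
Require Import Defs.
From HB Require Import structures.
From mathcomp Require Import all_boot all_order all_algebra all_field fraction.
From mathcomp Require Import mpoly ring.
From Stdlib Require Import ClassicalEpsilon FunctionalExtensionality.
Set Implicit Arguments. Unset Strict Implicit. Unset Printing Implicit Defensive.
Import GRing.Theory.
Local Open Scope ring_scope.

(** Let I be the ideal of the polynomials over K vanishing at H.  If f is in I,
    the coefficient of t in f(H + tp) is the sum of the lambda_i (D_i f)(H), with
    D_i the derivative along p^(i).  As soon as the algebra K[H] is linearly
    disjoint from Lt over K, every (D_i f)(H) vanishes, so D_i preserves I, and in
    characteristic zero Taylor's formula gives f(H + t p^(i)) = 0.  Linear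
    disjointness also shows that I spans the ideal of H over Lt.

    For linear disjointness, choose a transcendence basis h of K(H) over K among
    the components of H; the hypothesis on transcendence degrees and Steinitz
    exchange make h algebraically independent over L.  Then L and K(h) are
    linearly disjoint over K, and K(h) is algebraically closed in L(h).  By the
    primitive element theorem K[H] lies in K(h)(z) with z algebraic over K(h); the
    minimal polynomial of z over L(h) has coefficients algebraic over K(h), hence
    in K(h), so L(h) and K(h)(z) are linearly disjoint over K(h).  Finally L[x] and
    Lt are linearly disjoint over L. *)

(** * Transcendental extensions *)

(** In characteristic zero the images of the naturals are distinct, so only finitely many are roots.
    Each natural root is divided out and the bound moved past it. *)
Lemma horner_nat_neq0 (F : fieldType) (q : {poly F}) :
  [pchar F] =i pred0 -> q != 0 ->
  exists N, forall n, (N <= n)%N -> q.[n%:R] != 0.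
Proof.
move=> /pcharf0P ch0; elim: {q}(size q) {-2}q (leqnn (size q)) => [|s IH] q sq q0.
  by move: q0; rewrite -size_poly_leq0 sq.
case: (excluded_middle_informative (exists n : nat, root q n%:R)) => [[n rn]|h].
  have [q1 Dq] := factor_theorem _ _ rn.
  have q10 : q1 != 0 by apply: contraNneq q0 => q10; rewrite Dq q10 mul0r.
  have [|N hN] := IH q1 _ q10.
    by move: sq; rewrite Dq size_mul ?polyXsubC_eq0 // size_XsubC addn2.
  exists (maxn N n.+1) => k; rewrite geq_max => /andP[Nk nk].
  rewrite Dq hornerM mulf_neq0 ?hN // hornerXsubC -natrB ?(ltnW nk) //.
  by rewrite ch0 subn_eq0 -ltnNge.
by exists 0%N => n _; apply/negP => h1; apply: h; exists n.
Qed.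

(** Newton interpolation: subtracting the value at [N] and dividing by X - N leaves a smaller
    polynomial whose values at n > N are again in F, because n - N is nonzero in characteristic
    zero. *)
Lemma poly_descent (F M : fieldType) (i : {rmorphism F -> M}) (v : {poly M}) N :
  [pchar F] =i pred0 ->
  (forall n, (N <= n)%N -> exists c, v.[n%:R] = i c) ->
  exists v0, v = map_poly i v0.
Proof.
move=> ch0; have chM : [pchar M] =i pred0 by move=> x; rewrite (fmorph_pchar i) ch0.
elim: {v}(size v) {-2}v (leqnn (size v)) N => [|s IH] v sv N hv.
  by exists 0; rewrite rmorph0; apply/eqP; rewrite -size_poly_leq0.
have [c Dc] := hv N (leqnn _).
have /factor_theorem[v1 Dv] : root (v - (i c)%:P) N%:R.
  by rewrite /root hornerD hornerN hornerC Dc subrr.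
have {}Dv : v = v1 * ('X - N%:R%:P) + (i c)%:P by rewrite -Dv subrK.
have sv1 : (size v1 <= s)%N.
  have [->|v10] := eqVneq v1 0; first by rewrite size_poly0.
  move: sv; rewrite Dv size_polyDl size_mul ?polyXsubC_eq0 // size_XsubC addn2 //.
  by apply: leq_ltn_trans (size_polyC_leq1 _) _; rewrite ltnS size_poly_gt0.
have [n Nn|v0 Dv1] := IH v1 sv1 N.+1.
  have [b Db] := hv n (ltnW Nn).
  have nN0 : (n%:R - N%:R : F) != 0.
    by rewrite -natrB ?(ltnW Nn) //; move/pcharf0P: ch0 => ->; rewrite subn_eq0 -ltnNge.
  exists ((b - c) / (n%:R - N%:R)); rewrite fmorph_div !rmorphB !rmorph_nat -Db Dv.
  rewrite !hornerE addrK mulfK //.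
  by rewrite -(rmorph_nat i n) -(rmorph_nat i N) -rmorphB fmorph_eq0.
exists (v0 * ('X - N%:R%:P) + c%:P).
by rewrite rmorphD rmorphM rmorphB /= map_polyX !map_polyC /= rmorph_nat -Dv1.
Qed.

Lemma sum_homogenize (E : fieldType) (a : nat -> E) (f g : E) d : g != 0 ->
  \sum_(l < d.+1) a l * f ^+ l * g ^+ (d - l) = g ^+ d * \sum_(l < d.+1) a l * (f / g) ^+ l.
Proof.
move=> g0; rewrite mulr_sumr; apply: eq_bigr => l _; have ld : (l <= d)%N by rewrite -ltnS.
have -> : g ^+ d = g ^+ (d - l) * g ^+ l by rewrite -exprD subnK.
rewrite expr_div_n.
have gl : g ^+ l != 0 by rewrite expf_neq0.
by field.
Qed.

Section Transcendental.
Variables (F M E : fieldType) (i : {rmorphism F -> M}) (j : {rmorphism M -> E}).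
Variable h : E.
Hypothesis trh : forall q : {poly M}, (map_poly j q).[h] = 0 -> q = 0.

(** As [h] is transcendental over M, the relation is an identity in M[X]; each power of X then
    yields a relation of the [c k] over F. *)
Lemma lin_disj_transcendental s (c : 'I_s -> M) (q : 'I_s -> {poly F}) :
  (forall a : 'I_s -> F, \sum_k i (a k) * c k = 0 -> forall k, a k = 0) ->
  \sum_k j (c k) * (map_poly (j \o i) (q k)).[h] = 0 -> forall k, q k = 0.
Proof.
move=> ind rel k.
have Q0 : \sum_k c k *: map_poly i (q k) = 0.
  apply: trh; rewrite rmorph_sum /= horner_sum -[RHS]rel; apply: eq_bigr => l _.
  by rewrite linearZ /= hornerZ map_poly_comp.
apply/polyP => n; rewrite coef0; apply: (ind (fun k => (q k)`_n)).
have /(congr1 (fun p : {poly M} => p`_n)) := Q0.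
rewrite coef0 coef_sum => E0; rewrite -[RHS]E0; apply: eq_bigr => l _.
by rewrite coefZ coef_map mulrC.
Qed.

(* After clearing denominators f/g reads v/q with q over F.  At almost every natural
   number the value of f/g is algebraic over F, hence in F, so v takes values in F
   there and descends to F by [poly_descent]. *)
Lemma alg_closed_transcendental (f g : {poly M}) (Q : {poly {poly F}}) :
  [pchar F] =i pred0 -> alg_closed_in i -> g != 0 -> Q != 0 ->
  \sum_(l < size Q) (map_poly (j \o i) Q`_l).[h]
     * ((map_poly j f).[h] / (map_poly j g).[h]) ^+ l = 0 ->
  exists f0 g0 : {poly F}, g0 != 0 /\
    (map_poly j f).[h] / (map_poly j g).[h]
    = (map_poly (j \o i) f0).[h] / (map_poly (j \o i) g0).[h].
Proof.
move=> ch0 clF.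
have evN0 (q : {poly M}) : q != 0 -> (map_poly j q).[h] != 0.
  by apply: contraNneq => /trh ->.
(* Reduction to lowest terms, needed for the divisibility argument below. *)
wlog cop : f g / coprimep g f.
  move=> W g0 Q0 rel.
  have d0 : gcdp g f != 0 by rewrite gcdp_eq0 negb_and g0.
  have Df : f = f %/ gcdp g f * gcdp g f by rewrite divpK ?dvdp_gcdr.
  have Dg : g = g %/ gcdp g f * gcdp g f by rewrite divpK ?dvdp_gcdl.
  have eqr : (map_poly j f).[h] / (map_poly j g).[h]
    = (map_poly j (f %/ gcdp g f)).[h] / (map_poly j (g %/ gcdp g f)).[h].
    have -> : (map_poly j f).[h] = (map_poly j (f %/ gcdp g f)).[h] * (map_poly j (gcdp g f)).[h].
      by rewrite -hornerM -rmorphM -Df.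
    have -> : (map_poly j g).[h] = (map_poly j (g %/ gcdp g f)).[h] * (map_poly j (gcdp g f)).[h].
      by rewrite -hornerM -rmorphM -Dg.
    by rewrite -mulf_div divff ?mulr1 //; exact: evN0.
  rewrite eqr; apply: W => //; rewrite -?eqr //.
    by rewrite coprimep_div_gcd ?g0.
  by apply: contraNneq g0 => g1; rewrite Dg g1 mul0r.
move=> g0 Q0 rel.
set d := (size Q).-1; have Dd : size Q = d.+1 by rewrite prednK ?size_poly_gt0.
rewrite Dd in rel.
(* Multiplied by g(h)^d, the relation becomes an identity in M[X], since [h] is transcendental. *)
have hom : \sum_(l < d.+1) map_poly i Q`_l * f ^+ l * g ^+ (d - l) = 0.
  apply: trh; rewrite rmorph_sum horner_sum.
  under eq_bigr => l _ do rewrite !rmorphM !rmorphXn /= !hornerM !horner_exp -map_poly_comp.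
  by rewrite (sum_homogenize (fun l => (map_poly (j \o i) Q`_l).[h])) ?evN0 // rel mulr0.
(* Rational root argument: [g] divides every term of [hom] but the top one and is coprime to [f],
   hence divides the leading coefficient of [Q]. So f/g is [k * f] over a polynomial with
   coefficients in F. *)
have [k Dk] : exists k, map_poly i Q`_d = k * g.
  apply/dvdpP; rewrite -(@Gauss_dvdpl _ _ (f ^+ d)) ?coprimep_expr //.
  move: hom; rewrite big_ord_recr /= subnn expr0 mulr1 => /eqP.
  rewrite addrC addr_eq0 => /eqP ->; rewrite dvdpNr.
  apply: (big_ind (fun p => g %| p)) => [||l _]; first exact: dvdp0.
    by move=> p q; apply: dvdp_add.
  by rewrite dvdp_mull // dvdp_exp // subn_gt0 ltn_ord.
have qd0 : Q`_d != 0 by rewrite -lead_coefE lead_coef_eq0.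
have [N hN] := horner_nat_neq0 ch0 qd0.
have [n Nn|v0 Dv] := @poly_descent F M i (k * f) N ch0.
  have qn0 := hN n Nn.
  have Dkn : k.[n%:R] * g.[n%:R] = i (Q`_d).[n%:R].
    by rewrite -hornerM -Dk -(rmorph_nat i) horner_map.
  have gn0 : g.[n%:R] != 0.
    by apply: contraNneq qn0 => gn0; move/eqP: Dkn; rewrite gn0 mulr0 eq_sym fmorph_eq0.
  have [|c Dc] := clF (f.[n%:R] / g.[n%:R]).
    exists (\poly_(l < d.+1) (Q`_l).[n%:R]).
      by apply: contraNneq qn0 => /(congr1 (fun p : {poly F} => p`_d)); rewrite coef_poly ltnSn coef0 => ->.
    have /(congr1 (fun p : {poly M} => p.[n%:R])) := hom.
    rewrite horner_sum horner0.
    under eq_bigr => l _ do rewrite !hornerM !horner_exp.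
    rewrite (sum_homogenize (fun l => (map_poly i Q`_l).[n%:R])) //.
    move/eqP; rewrite mulf_eq0 expf_eq0 (negPf gn0) andbF /= => rt.
    rewrite /root (@horner_coef_wide _ d.+1) ?size_map_poly ?size_poly //.
    apply/eqP; rewrite -[RHS](eqP rt); apply: eq_bigr => l _.
    by rewrite coef_map coef_poly ltn_ord -(rmorph_nat i) horner_map.
  exists (c * (Q`_d).[n%:R]); rewrite rmorphM -Dc -Dkn hornerM.
  by field.
exists v0, Q`_d; split => //.
rewrite !map_poly_comp -Dv Dk !rmorphM !hornerM.
have k0 : k != 0.
  by apply: contraNneq qd0 => k0; rewrite -(map_poly_eq0 i) Dk k0 mul0r.
by rewrite -mulf_div divff ?mul1r // evN0.
Qed.

End Transcendental.

(** * Algebraic extensions *)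

(** Passing to proper divisors lowers the size until an irreducible factor is reached; adjoining a
    root of that factor gives [N]. *)
Lemma exists_root_extension (M : fieldType) (p : {poly M}) : (1 < size p)%N ->
  exists (N : fieldType) (f : {rmorphism M -> N}) (z : N), root (map_poly f p) z.
Proof.
elim: {p}(size p) {-2}p (leqnn (size p)) => [|s IH] p sp p1.
  by have := leq_trans p1 sp.
have p0 : p != 0 by rewrite -size_poly_gt0 ltnW.
case: (excluded_middle_informative (irreducible_poly p)) => [irr|nirr].
  have [N _ [z rz _]] := irredp_FAdjoin irr.
  by exists N, (in_alg N), z.
case: (excluded_middle_informative
  (exists q : {poly M}, [/\ size q != 1%N, q %| p & ~~ (q %= p)])) => [[q [q1 qp nqp]]|h].
  have q0 : q != 0 by apply: contraTneq qp => ->; rewrite dvd0p.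
  have sq : (size q < size p)%N.
    by rewrite ltn_neqAle dvdp_leq // andbT dvdp_size_eqp.
  have [||N [f [z rz]]] := IH q.
  - by rewrite -ltnS (leq_trans sq).
  - by rewrite ltn_neqAle eq_sym q1 size_poly_gt0.
  exists N, f, z; move/dvdpP: qp => [r ->]; by rewrite rmorphM rootM rz orbT.
case: nirr; split=> // q q1 qp; apply/negPn/negP => nqp.
by apply: h; exists q.
Qed.

(* Roots of v are split off one at a time in extensions of M. *)
Lemma coef_monic_dvd_algebraic (F : fieldType) (p : {poly F}) : p != 0 ->
  forall (s : nat) (M : fieldType) (i : {rmorphism F -> M}) (v : {poly M}),
  (size v <= s)%N -> v \is monic -> v %| map_poly i p ->
  forall k, algebraicOver i v`_k.
Proof.
move=> p0; elim=> [|s IH] M i v sv mv vp k.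
  by case/negP: (monic_neq0 mv); rewrite -size_poly_leq0.
have [sv1|sv1] := leqP (size v) 1.
  move: mv; rewrite (size1_polyC sv1) monicE lead_coefC coefC => /eqP ->.
  by case: eqP => _; [exact: algebraic1 | exact: algebraic0].
have [N [f [z rz]]] := exists_root_extension sv1.
have [v1 Dv] := factor_theorem _ _ rz.
have mv1 : v1 \is monic by rewrite -(monicMr v1 (monicXsubC z)) -Dv map_monic.
have Dp : map_poly (f \o i) p = map_poly f (map_poly i p) by rewrite map_poly_comp.
have fv : map_poly f v %| map_poly (f \o i) p by rewrite Dp dvdp_map.
have v1p : v1 %| map_poly (f \o i) p by apply: dvdp_trans fv; rewrite Dv dvdp_mulIl.
have sv1s : (size v1 <= s)%N.
  move: sv; rewrite -(size_map_poly f) Dv size_mul ?polyXsubC_eq0 ?monic_neq0 //.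
  by rewrite size_XsubC addn2.
have algv1 := IH N (f \o i) v1 sv1s mv1 v1p.
have algz : algebraicOver (f \o i) z.
  by exists p => //; move/dvdpP: fv => [q ->]; rewrite rootM rz orbT.
(* From v = v1 * (X - z), the k-th coefficient is that of v1 at k - 1 (or 0 for k = 0) minus z times
   that at k. The equation found in N holds in M because [f] is injective. *)
have [q q0 rq] : algebraicOver (f \o i) (f v`_k).
  rewrite -coef_map Dv mulrBr coefB coefMX coefMC.
  apply: algebraic_sub; last exact: algebraic_mul.
  by case: ifP => _; [exact: algebraic0|].
exists q => //; move: rq; rewrite map_poly_comp /root horner_map fmorph_eq0; exact.
Qed.

Section Algebraic.
Variables (F M E : fieldType) (i : {rmorphism F -> M}) (j : {rmorphism M -> E}).
Variable z : E.

Lemma exists_min_poly (p : {poly M}) : p != 0 -> (map_poly j p).[z] = 0 ->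
  exists v : {poly M}, [/\ v \is monic, (map_poly j v).[z] = 0 &
    forall q, (map_poly j q).[z] = 0 -> v %| q].
Proof.
elim: {p}(size p) {-2}p (leqnn (size p)) => [|s IH] p sp p0 rp.
  by move: p0; rewrite -size_poly_leq0 sp.
case: (excluded_middle_informative (exists q : {poly M},
   [/\ q != 0, (map_poly j q).[z] = 0 & (size q < size p)%N])) => [[q [q0 rq sq]]|h].
  by apply: (IH q) => //; rewrite -ltnS (leq_trans sq).
have lp0 : lead_coef p != 0 by rewrite lead_coef_eq0.
exists ((lead_coef p)^-1 *: p); split.
- by rewrite monicE lead_coefZ mulVf.
- by rewrite linearZ /= hornerZ rp mulr0.
move=> q rq; rewrite dvdpZl ?invr_eq0 //; apply/negPn/negP => np.
apply: h; exists (q %% p); split.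
- by apply/negP => /eqP/modp_eq0P; apply/negP.
- move: rq; rewrite {1}(divp_eq q p) rmorphD rmorphM /= hornerD hornerM rp mulr0 add0r; exact.
- by rewrite ltn_modp.
Qed.

(** The minimal polynomial [v] of [z] over M is defined over F, so each [q k] may be reduced modulo
    it. The relation is then smaller than [v], hence zero in M[X], and its coefficients are
    relations of the [c k] over F. *)
Lemma lin_disj_algebraic s (c : 'I_s -> M) (q : 'I_s -> {poly F}) :
  alg_closed_in i -> algebraicOver (j \o i) z ->
  (forall a : 'I_s -> F, \sum_k i (a k) * c k = 0 -> forall k, a k = 0) ->
  \sum_k j (c k) * (map_poly (j \o i) (q k)).[z] = 0 ->
  forall k, (map_poly (j \o i) (q k)).[z] = 0.
Proof.
move=> clF [p p0 rp] ind rel k.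
have [||v [mv rv minv]] := @exists_min_poly (map_poly i p).
- by rewrite map_poly_eq0.
- by rewrite -map_poly_comp; apply/eqP.
have vp : v %| map_poly i p by apply: minv; rewrite -map_poly_comp; apply/eqP.
have [v0 Dv] : exists v0, v = map_poly i v0.
  have algv n : exists c, v`_n = i c.
    exact/clF/(coef_monic_dvd_algebraic p0 (leqnn _) mv vp).
  pose b n := proj1_sig (constructive_indefinite_description _ (algv n)).
  have Db n : v`_n = i (b n) := proj2_sig (constructive_indefinite_description _ (algv n)).
  exists (\poly_(n < size v) b n); apply/polyP => n; rewrite coef_map coef_poly.
  case: ltnP => h; first exact: Db.
  by rewrite (nth_default _ h); exact/esym/(rmorph0 i).
have v00 : v0 != 0 by rewrite -(map_poly_eq0 i) -Dv monic_neq0.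
have rv0 : (map_poly (j \o i) v0).[z] = 0 by rewrite map_poly_comp -Dv.
have qmod l : (map_poly (j \o i) (q l %% v0)).[z] = (map_poly (j \o i) (q l)).[z].
  by rewrite [in RHS](divp_eq (q l) v0) rmorphD rmorphM /= hornerD hornerM rv0 mulr0 add0r.
have Q0 : \sum_k c k *: map_poly i (q k %% v0) = 0.
  apply/eqP; apply: contraTT (leqnn (size v)) => Qn0; rewrite -ltnNge.
  have vQ : v %| \sum_k c k *: map_poly i (q k %% v0).
    apply: minv; rewrite rmorph_sum /= horner_sum -[RHS]rel; apply: eq_bigr => l _.
    by rewrite linearZ /= hornerZ -map_poly_comp qmod.
  apply: leq_ltn_trans (dvdp_leq Qn0 vQ) _.
  rewrite [in ltnRHS]Dv size_map_poly -(prednK (_ : 0 < size v0)%N) ?size_poly_gt0 // ltnS.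
  apply: (leq_trans (size_sum _ _ _)); apply/bigmax_leqP => l _.
  apply: leq_trans (size_scale_leq _ _) _; rewrite size_map_poly -ltnS prednK ?size_poly_gt0 //.
  by rewrite ltn_modp.
rewrite -qmod; suff -> : q k %% v0 = 0 by rewrite rmorph0 horner0.
apply/polyP => n; rewrite coef0; apply: (ind (fun k => (q k %% v0)`_n)).
have /(congr1 (fun p : {poly M} => p`_n)) := Q0.
rewrite coef0 coef_sum => E0; rewrite -[RHS]E0; apply: eq_bigr => l _.
by rewrite coefZ coef_map mulrC.
Qed.
End Algebraic.

(** * Subfields and linear disjointness *)

Definition decb (P : Prop) : bool :=
  if excluded_middle_informative P then true else false.

Lemma decbP (P : Prop) : reflect P (decb P).
Proof. by rewrite /decb; case: excluded_middle_informative => h; constructor. Qed.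

(** Counterpart of [divring_closed] for Prop-valued predicates, such as being a fraction or being
    algebraic. *)
Definition subfield_pred (E : fieldType) (S : E -> Prop) : Prop :=
  [/\ S 1, forall x y, S x -> S y -> S (x - y) & forall x y, S x -> S y -> S (x / y)].

(** The generated subfield, as the intersection of all subfields containing A. It is made boolean so
    as to carry a [divringClosed] structure. *)
Definition gen (E : fieldType) (A : E -> Prop) : {pred E} := fun x =>
  decb (forall S : E -> Prop, subfield_pred S -> (forall y, A y -> S y) -> S x).

Lemma gen_divring_closed (E : fieldType) (A : E -> Prop) : divring_closed (gen A).
Proof.
split.
- by apply/decbP => S [].
- move=> x y /decbP hx /decbP hy; apply/decbP => S cS hS; case: (cS) => _ cB _.
  by apply: cB; [exact: hx | exact: hy].
- move=> x y /decbP hx /decbP hy; apply/decbP => S cS hS; case: (cS) => _ _ cD.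
  by apply: cD; [exact: hx | exact: hy].
Qed.

HB.instance Definition _ (E : fieldType) (A : E -> Prop) :=
  GRing.isDivringClosed.Build E (gen A) (gen_divring_closed A).

Lemma mem_gen (E : fieldType) (A : E -> Prop) x : A x -> x \in gen A.
Proof. by move=> Ax; apply/decbP => S _; apply. Qed.

Lemma gen_min (E : fieldType) (A S : E -> Prop) x :
  subfield_pred S -> (forall y, A y -> S y) -> x \in gen A -> S x.
Proof. by move=> cS AS /decbP; apply. Qed.

Lemma subfield_pred_mem (E : fieldType) (S : divringClosed E) :
  subfield_pred (fun x => x \in S).
Proof. by split; [exact: rpred1 | exact: rpredB | exact: rpred_div]. Qed.

(** A subfield turned into a field type, so that one can form polynomials over it and apply the
    results on abstract field extensions. *)
Record sub_field (E : fieldType) (S : divringClosed E) :=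
  SubField { sf_val : E; _ : sf_val \in S }.
HB.instance Definition _ (E : fieldType) (S : divringClosed E) :=
  [isSub for @sf_val E S].
HB.instance Definition _ (E : fieldType) (S : divringClosed E) :=
  [Choice of sub_field S by <:].
HB.instance Definition _ (E : fieldType) (S : divringClosed E) :=
  [SubChoice_isSubIntegralDomain of sub_field S by <:].
HB.instance Definition _ (E : fieldType) (S : divringClosed E) :=
  [SubIntegralDomain_isSubField of sub_field S by <:].

Definition sval_of (E : fieldType) (S : divringClosed E) : {rmorphism sub_field S -> E} := \val.

Definition incl (E : fieldType) (S T : divringClosed E) (ST : {subset S <= T})
  (x : sub_field S) : sub_field T := SubField (ST _ (valP x)).

Lemma incl_zmod_morphism (E : fieldType) (S T : divringClosed E) (ST : {subset S <= T}) :
  zmod_morphism (incl ST).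
Proof. by move=> x y; apply: val_inj. Qed.
Lemma incl_monoid_morphism (E : fieldType) (S T : divringClosed E) (ST : {subset S <= T}) :
  monoid_morphism (incl ST).
Proof.
by split=> [|x y]; apply: val_inj.
Qed.
HB.instance Definition _ (E : fieldType) (S T : divringClosed E) (ST : {subset S <= T}) :=
  GRing.isZmodMorphism.Build _ _ (incl ST) (incl_zmod_morphism ST).
HB.instance Definition _ (E : fieldType) (S T : divringClosed E) (ST : {subset S <= T}) :=
  GRing.isMonoidMorphism.Build _ _ (incl ST) (incl_monoid_morphism ST).

Section LinDisj.
Variable E : fieldType.
Implicit Types (S T K L : divringClosed E) (A B : E -> Prop).

Definition lin_indep S s (c : 'I_s -> E) : Prop :=
  forall a : 'I_s -> E, (forall k, a k \in S) -> \sum_k a k * c k = 0 -> forall k, a k = 0.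

(* The asymmetric form is the one that composes along towers. *)
Definition lin_disj S A B : Prop :=
  forall s (c u : 'I_s -> E), (forall k, A (c k)) -> (forall k, B (u k)) ->
  lin_indep S c -> \sum_k c k * u k = 0 -> forall k, u k = 0.

(** Induction on the length. If [c] is independent over S, disjointness makes the independent family
    [u] vanish, which is absurd. Otherwise some [c k] is an S-combination of the others; eliminating
    it replaces [u] by the elements u l - b l * u k, which lie in B by the closure hypothesis and
    remain independent. *)
Lemma lin_disj_sym S A B :
  (forall x y a, a \in S -> B x -> B y -> B (x - a * y)) ->
  lin_disj S A B -> lin_disj S B A.
Proof.
move=> hB D s; elim: s => [|s IH] u c Bu Ac indu rel; first by case.
case: (excluded_middle_informative (lin_indep S c)) => [indc|nindc].
  have u0 : forall k, u k = 0.
    by apply: (D _ c u) => //; rewrite -[RHS]rel; apply: eq_bigr => l _; rewrite mulrC.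
  have := indu (fun k => (k == 0)%:R) _ _ 0; rewrite eqxx => h.
  case/eqP: (oner_neq0 E); apply: h => [k|]; first exact: rpred_nat.
  by rewrite big1 // => k _; rewrite u0 mulr0.
have [a [aS [rela [k ak]]]] : exists a : 'I_s.+1 -> E,
    (forall k, a k \in S) /\ \sum_k a k * c k = 0 /\ exists k, a k != 0.
  apply: NNPP => h; apply: nindc => a aS ra k; apply/eqP/negPn/negP => ak.
  by apply: h; exists a; split=> //; split=> //; exists k.
pose b l := a (lift k l) / a k.
have bS l : b l \in S by rewrite rpred_div.
have ck : c k = - \sum_l b l * c (lift k l).
  move: rela; rewrite (bigD1_ord k) //= => /eqP; rewrite addr_eq0 => /eqP rela.
  apply: (mulfI ak); rewrite rela mulrN mulr_sumr; congr (- _); apply: eq_bigr => l _.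
  by rewrite /b; field.
have c0 : forall l, c (lift k l) = 0.
  apply: (IH (fun l => u (lift k l) - b l * u k)) => // [l|d dS reld l|].
  - by apply: hB.
  (* A relation [d] among the new elements is a relation among the old ones, the coefficient of
     [u k] collecting the subtracted multiples. *)
  - pose d' l := if unlift k l is Some l' then d l' else - \sum_m d m * b m.
    have := indu d' _ _ (lift k l); rewrite /d' liftK; apply.
      move=> m; case: unlift => [m'|] //.
      by rewrite rpredN rpred_sum // => m' _; rewrite rpredM.
    rewrite (bigD1_ord k) //= unlift_none -[RHS]reld mulNr mulr_suml addrC -sumrB.
    by apply: eq_bigr => m _; rewrite liftK; ring.
  rewrite -[RHS]rel (bigD1_ord k) //= ck mulrN mulr_sumr addrC -sumrB.
  by apply: eq_bigr => m _; ring.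
move=> l; case: (unliftP k l) => [m ->|->] //.
by rewrite ck big1 ?oppr0 // => m _; rewrite c0 mulr0.
Qed.

(** Since T lies in B, the first disjointness keeps a family of A that is independent over S
    independent over T; the second then applies to it. *)
Lemma lin_disj_tower S T A A' B B' :
  (forall x, x \in T -> B x) -> (forall x, A x -> A' x) ->
  lin_disj S A B -> lin_disj T A' B' -> lin_disj S A B'.
Proof.
move=> TB AA' D D' s c u Ac Bu indc.
apply: D' => [k|//|a aT rela k]; first exact: AA'.
apply: (D _ c a) => // [l|]; first exact: TB.
by rewrite -[RHS]rela; apply: eq_bigr => l _; rewrite mulrC.
Qed.

Lemma lin_disj_sub S A A' B B' :
  (forall x, A' x -> A x) -> (forall x, B' x -> B x) -> lin_disj S A B -> lin_disj S A' B'.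
Proof. by move=> hA hB D s c u Ac Bu; apply: D => k; [exact: hA | exact: hB]. Qed.

End LinDisj.

(** * Adjunction and algebraic dependence *)

Definition alg_over (E : fieldType) (S : divringClosed E) (x : E) : Prop :=
  algebraicOver (sval_of S) x.

Section Fractions.
Variables (E : fieldType) (R : comNzRingType) (e : {rmorphism R -> E}).

(** Applied with [e] the evaluation of polynomials, in one or in several variables; as [e] may have
    a kernel, the value of the denominator is what must be nonzero. *)
Definition is_frac (x : E) : Prop := exists p q : R, e q != 0 /\ x = e p / e q.

Lemma subfield_pred_frac : subfield_pred is_frac.
Proof.
split; first by exists 1, 1; rewrite rmorph1 divr1 oner_neq0.
  move=> _ _ [p1 [q1 [q10 ->]]] [p2 [q2 [q20 ->]]].
  exists (p1 * q2 - p2 * q1), (q1 * q2); rewrite rmorphB !rmorphM mulf_neq0 //; split=> //.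
  by field; rewrite q10 q20.
move=> _ _ [p1 [q1 [q10 ->]]] [p2 [q2 [q20 ->]]].
have [p20|p20] := eqVneq (e p2) 0.
  by exists 0, 1; rewrite p20 rmorph0 rmorph1 oner_neq0 mul0r invr0 mulr0 mul0r.
exists (p1 * q2), (q1 * p2); rewrite !rmorphM mulf_neq0 //; split=> //.
by field; rewrite p20 q10 q20.
Qed.

Lemma common_denominator n (x : 'I_n -> E) : (forall k, is_frac (x k)) ->
  exists (G : R) (P : 'I_n -> R), e G != 0 /\ forall k, x k = e (P k) / e G.
Proof.
move=> xS.
have [p hp] := fin_all_exists xS.
have [q hq] := fin_all_exists hp.
exists (\prod_k q k), (fun k => p k * \prod_(l | l != k) q l).
split=> [|k].
  by rewrite rmorph_prod; apply/prodf_neq0 => k _; case: (hq k).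
have [qk0 ->] := hq k.
rewrite rmorphM !rmorph_prod [X in _ = _ / X](bigD1 k) //= -mulf_div divff ?mulr1 //.
by apply/prodf_neq0 => l _; case: (hq l).
Qed.

(** A common denominator moves the coefficients of an equation of [w] to R. That the equation is
    nontrivial is stated after applying [e], which may have a kernel. *)
Lemma alg_over_clear (T : divringClosed E) w : (forall x, x \in T -> is_frac x) -> alg_over T w ->
  exists2 Q : {poly R}, (exists l, e Q`_l != 0) &
    \sum_(l < size Q) e Q`_l * w ^+ l = 0.
Proof.
move=> Tfrac [q q0 rq].
have [|G [P [G0 DP]]] := @common_denominator (size q) (fun k => val q`_k).
  by move=> k; apply: Tfrac; exact: valP.
(* [insub] turns an exponent below [size q] into an index of [P]; the default 0 is never reached. *)
pose Q := \poly_(l < size q) (if insub l is Some k then P k else 0).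
have DQ (k : 'I_(size q)) : Q`_k = P k by rewrite coef_poly ltn_ord valK.
have sq : (0 < size q)%N by rewrite size_poly_gt0.
have ltp : ((size q).-1 < size q)%N by rewrite prednK.
have eP (k : 'I_(size q)) : e (P k) = val q`_k * e G by rewrite DP divfK.
exists Q.
  exists (size q).-1; rewrite (DQ (Ordinal ltp)) eP mulf_neq0 //=.
  by rewrite (fmorph_eq0 (sval_of T)) -lead_coefE lead_coef_eq0.
have -> : size Q = size q.
  apply: size_poly_eq; rewrite (_ : insub _ = Some (Ordinal ltp)); last exact: (valK (Ordinal ltp)).
  apply: contraTneq (_ : e (P (Ordinal ltp)) != 0) => [->|]; first by rewrite rmorph0 eqxx.
  rewrite eP mulf_neq0 //=.
  by rewrite (fmorph_eq0 (sval_of T)) -lead_coefE lead_coef_eq0.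
move/eqP: rq; rewrite horner_coef size_map_poly => rq.
apply: (mulIf (invr_neq0 G0)); rewrite mul0r -[RHS]rq mulr_suml; apply: eq_bigr => k _.
by rewrite DQ eP coef_map mulrAC mulfK.
Qed.

End Fractions.

Section Closure.
Variable E : fieldType.
Implicit Types (S T K L : divringClosed E) (s t : seq E) (x y z w : E).

Definition adj S s : divringClosed E := gen (fun x => x \in S \/ x \in s).

Lemma adj_base S s x : x \in S -> x \in adj S s.
Proof. by move=> h; apply: mem_gen; left. Qed.

Lemma adj_mem S s x : x \in s -> x \in adj S s.
Proof. by move=> h; apply: mem_gen; right. Qed.

Lemma adj_min S s T x :
  {subset S <= T} -> {subset s <= T} -> x \in adj S s -> x \in T.
Proof. by move=> h1 h2; apply: gen_min (subfield_pred_mem T) _ => y [/h1|/h2]. Qed.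

Lemma adj_mono S s T t :
  {subset S <= T} -> {subset s <= t} -> {subset adj S s <= adj T t}.
Proof.
move=> h1 h2 x; apply: adj_min => y.
  by move/h1; apply: adj_base.
by move/h2; apply: adj_mem.
Qed.

Lemma adj_cons_sub S s y : {subset adj S (y :: s) <= adj (adj S s) [:: y]}.
Proof.
move=> x; apply: adj_min => w; first by move=> ?; do 2!apply: adj_base.
rewrite inE => /orP[/eqP ->|ws]; first by apply: adj_mem; rewrite inE.
by apply: adj_base; apply: adj_mem.
Qed.

Lemma adj_cons_sup S s y : {subset adj (adj S s) [:: y] <= adj S (y :: s)}.
Proof.
move=> x; apply: adj_min.
  by apply: adj_mono => // w ws; rewrite inE ws orbT.
by move=> w; rewrite inE => /eqP ->; apply: adj_mem; rewrite inE eqxx.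
Qed.

Lemma alg_over_base S x : x \in S -> alg_over S x.
Proof. by move=> xS; exact: (algebraic_id (sval_of S) (SubField xS)). Qed.

Lemma subfield_pred_alg_over S : subfield_pred (alg_over S).
Proof.
split; first exact: algebraic1.
  by move=> x y; apply: algebraic_sub.
by move=> x y; apply: algebraic_div.
Qed.

Lemma alg_over_mono S T x : {subset S <= T} -> alg_over S x -> alg_over T x.
Proof.
move=> ST [p p0 rp]; exists (map_poly (incl ST) p); first by rewrite map_poly_eq0.
by rewrite -map_poly_comp.
Qed.

(** Over a field algebraic means integral, and a root of a monic polynomial with integral
    coefficients is integral. *)
Lemma alg_over_trans S T x : (forall y, y \in T -> alg_over S y) -> alg_over T x -> alg_over S x.
Proof.
move=> ST /integral_algebraic[p mp rp]; apply/integral_algebraic.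
apply: (integral_root_monic _ rp); first by rewrite map_monic.
apply/integral_poly => k; rewrite coef_map; apply/integral_algebraic/ST.
exact: valP.
Qed.

Lemma alg_over_adj S s T x :
  {subset S <= T} -> (forall y, y \in s -> alg_over T y) -> alg_over (adj S s) x -> alg_over T x.
Proof.
move=> ST sT; apply: alg_over_trans => y; apply: gen_min (subfield_pred_alg_over T) _ => w [wS|/sT //].
exact/alg_over_base/ST.
Qed.

Definition ev S z : {rmorphism {poly sub_field S} -> E} :=
  horner_eval z \o map_poly (sval_of S).

Lemma evE S z p : ev S z p = (map_poly (sval_of S) p).[z].
Proof. by []. Qed.

Lemma adj1_frac S z x : x \in adj S [:: z] -> is_frac (ev S z) x.
Proof.
apply: gen_min (subfield_pred_frac _) _ => y [yS|].
  exists (SubField yS)%:P, 1; rewrite rmorph1 oner_neq0 divr1; split=> //.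
  by rewrite evE (map_polyC (sval_of S)) hornerC.
rewrite inE => /eqP ->; exists 'X, 1.
by rewrite rmorph1 evE map_polyX hornerX oner_neq0 divr1.
Qed.

Lemma adj1_horner S z (p : {poly sub_field S}) : ev S z p \in adj S [:: z].
Proof.
have zz : z \in adj S [:: z] by apply: adj_mem; rewrite inE.
rewrite evE horner_coef; apply: rpred_sum => k _; apply: rpredM; last exact: rpredX.
by rewrite coef_map; apply: adj_base; exact: valP.
Qed.

(** A common denominator turns elements of K(h) into polynomials in [h] over K, to which
    [lin_disj_transcendental] applies. *)
Lemma lin_disj_adj_transcendental K L h : {subset K <= L} -> ~ alg_over L h ->
  lin_disj K (fun x => x \in L) (fun x => x \in adj K [:: h]).
Proof.
move=> KL trh s c u cL uK indc rel.
have [G [P [G0 DP]]] := common_denominator (fun k => adj1_frac (uK k)).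
suff P0 : forall k, P k = 0.
  by move=> k; rewrite DP P0 rmorph0 mul0r.
apply: (@lin_disj_transcendental _ _ _ (incl KL) (sval_of L) h _ s
  (fun k => SubField (cL k))).
- move=> q rq; apply/eqP/negPn/negP => q0; apply: trh; exists q => //; exact/eqP.
- move=> a rela k; apply: val_inj; apply: (indc (fun k => val (a k))) => [l|]; first exact: valP.
  have := congr1 val rela; rewrite rmorph_sum => E0; rewrite -[RHS]E0; apply: eq_bigr => l _.
  by rewrite rmorphM.
apply: (mulIf (invr_neq0 G0)); rewrite mul0r -[RHS]rel mulr_suml; apply: eq_bigr => k _.
by rewrite DP mulrA.
Qed.

(** K is algebraically closed in L; in characteristic zero, for K inside L, this is regularity of
    the extension. *)
Definition regular_in K L := forall x, x \in L -> alg_over K x -> x \in K.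

Lemma regular_alg_closed K L (KL : {subset K <= L}) :
  regular_in K L -> alg_closed_in (incl KL).
Proof.
move=> reg a [q q0 rq].
have aK : val a \in K.
  apply: reg; first exact: valP.
  exists q => //; rewrite (_ : map_poly _ _ = map_poly (sval_of L) (map_poly (incl KL) q)).
    by rewrite /root horner_map fmorph_eq0.
  by rewrite -map_poly_comp.
by exists (SubField aK); apply: val_inj.
Qed.

(** Write the element as f(h)/g(h) over L and clear its equation to coefficients in K[h];
    [alg_closed_transcendental] then rewrites the quotient over K. *)
Lemma regular_adj_transcendental K L h : [pchar E] =i pred0 ->
  {subset K <= L} -> regular_in K L -> ~ alg_over L h ->
  regular_in (adj K [:: h]) (adj L [:: h]).
Proof.
move=> ch0 KL reg trh w wL algw.
have [f [g [g0 Dw]]] := adj1_frac wL.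
have [Q [l Ql] rel] := alg_over_clear (@adj1_frac K h) algw.
have [|||||f0 [g1 [g10 Dw1]]] := @alg_closed_transcendental _ _ _ (incl KL) (sval_of L) h _ f g Q _ 
  (regular_alg_closed reg).
- move=> q rq; apply/eqP/negPn/negP => q0; apply: trh; exists q => //; exact/eqP.
- by move=> x; rewrite -(fmorph_pchar (sval_of K)) ch0.
- by apply: contraNneq g0 => ->; rewrite rmorph0.
- by apply: contraNneq Ql => ->; rewrite coef0 rmorph0.
- by rewrite -[RHS]rel; apply: eq_bigr => m _; rewrite Dw.
rewrite Dw Dw1 rpred_div //; exact: adj1_horner.
Qed.

(** The equation of [y] over T(x), cleared of denominators, is reordered by powers of [x] into an
    equation [R] of [x] over T[y]. Were [R] zero, one of its coefficients would be a nontrivial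
    equation of [y] over T. *)
Lemma alg_over_exchange1 T x y :
  alg_over (adj T [:: x]) y -> ~ alg_over T y -> alg_over (adj T [:: y]) x.
Proof.
move=> /(alg_over_clear (@adj1_frac T x))[Q [l Ql] rel] ntr.
pose R := \sum_(l < size Q) (map_poly (sval_of T) Q`_l) * (y ^+ l)%:P.
have Rc m : R`_m = \sum_(l < size Q) val Q`_l`_m * y ^+ l.
  by rewrite coef_sum; apply: eq_bigr => k _; rewrite coefMC coef_map.
have RT m : R`_m \in adj T [:: y].
  have yy : y \in adj T [:: y] by apply: adj_mem; rewrite inE.
  rewrite Rc; apply: rpred_sum => k _; apply: rpredM; last exact: rpredX.
  by apply: adj_base; exact: valP.
exists (\poly_(m < size R) SubField (RT m)).
  have [m Qm] : exists m, Q`_l`_m != 0.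
    exists (size Q`_l).-1; rewrite -lead_coefE lead_coef_eq0.
    by apply: contraNneq Ql => ->; rewrite rmorph0.
  have Rm : R`_m != 0.
    apply/negP => /eqP Rm; apply: ntr; exists (\poly_(l < size Q) Q`_l`_m).
      apply: contraNneq Qm => /(congr1 (fun p : {poly _} => p`_l)); rewrite coef_poly coef0.
      by case: ltnP => [_ ->|h _] //; rewrite (nth_default _ h) coef0.
    rewrite /root (@horner_coef_wide _ (size Q)) ?size_map_poly ?size_poly //.
    apply/eqP; rewrite -[RHS]Rm Rc; apply: eq_bigr => k _.
    by rewrite coef_map coef_poly ltn_ord.
  apply: contraNneq Rm => /(congr1 (fun p : {poly _} => val p`_m)); rewrite coef_poly coef0.
  by case: ltnP => [_ /= ->|h _] //; rewrite (nth_default _ h).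
rewrite (_ : map_poly _ _ = R).
  rewrite /root /R horner_sum -[X in _ == X]rel; apply/eqP; apply: eq_bigr => k _.
  by rewrite hornerM hornerC.
apply/polyP => m; rewrite coef_map coef_poly; case: ltnP => // h.
by rewrite (nth_default _ h); exact: (rmorph0 (sval_of _)).
Qed.

End Closure.

(** * Steinitz exchange and towers *)

Section Dependence.
Variable E : fieldType.
Implicit Types (S T K L : divringClosed E) (s t : seq E) (x y z w : E).

Lemma alg_over_adj_mono S s t x :
  {subset s <= t} -> alg_over (adj S s) x -> alg_over (adj S t) x.
Proof. by move=> st; apply: alg_over_mono; apply: adj_mono. Qed.

Lemma alg_over_adj_mem S s x : x \in s -> alg_over (adj S s) x.
Proof. by move=> xs; apply/alg_over_base/adj_mem. Qed.

Lemma alg_over_adj_trans S s t x :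
  (forall y, y \in s -> alg_over (adj S t) y) -> alg_over (adj S s) x -> alg_over (adj S t) x.
Proof. by move=> h; apply: alg_over_adj h => y; apply: adj_base. Qed.

Lemma alg_over_exchange S s x y :
  alg_over (adj S (x :: s)) y -> ~ alg_over (adj S s) y -> alg_over (adj S (y :: s)) x.
Proof.
move=> h1 h2; apply: alg_over_mono (@adj_cons_sup _ _ _ _) _.
by apply: alg_over_exchange1 h2; apply: alg_over_mono (@adj_cons_sub _ _ _ _) h1.
Qed.

(** Algebraic independence in the form of a tower of simple transcendental extensions, built from
    the end of the list. *)
Fixpoint tower_indep S s : Prop :=
  if s is y :: s' then ~ alg_over (adj S s') y /\ tower_indep S s' else True.

(** Entries are dropped from the front of [s] while [y] stays algebraic; [x] is the first whose
    removal destroys this, so it can be exchanged with [y]. *)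
Lemma exchange_split S t s y : alg_over (adj S (t ++ s)) y -> ~ alg_over (adj S t) y ->
  exists a x b, s = a ++ x :: b /\ alg_over (adj S (y :: t ++ b)) x.
Proof.
move=> h nt; elim: s h => [|x s IH]; first by rewrite cats0.
case: (excluded_middle_informative (alg_over (adj S (t ++ s)) y)) => [/IH|nts hx].
  by move=> [a [x' [b [-> hx']]]] _; exists (x :: a), x', b.
exists [::], x, s; split=> //; apply: alg_over_exchange nts.
apply: alg_over_adj_mono hx => w; rewrite !(inE, mem_cat).
by case/or3P => ->; rewrite ?orbT.
Qed.

(** Induction on the independent list: its head is algebraic over the tail together with [s'], but
    not over the tail alone, so it can replace one entry of [s']. *)
Lemma steinitz S s t : tower_indep S t -> (forall x, x \in t -> alg_over (adj S s) x) ->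
  exists s', (size s' + size t)%N = size s /\
    forall x, x \in s -> alg_over (adj S (t ++ s')) x.
Proof.
elim: t => [|y t IH] /=.
  by move=> _ _; exists s; split=> [|x]; [rewrite addn0 | apply: alg_over_adj_mem].
move=> [ny it] hs.
have [|s' [ss' hs']] := IH it; first by move=> x xt; apply: hs; rewrite inE xt orbT.
have hy : alg_over (adj S (t ++ s')) y.
  by apply: alg_over_adj_trans hs' _; apply: hs; rewrite inE eqxx.
have [a [x [b [Ds' hx]]]] := exchange_split hy ny.
exists (a ++ b); split.
  by rewrite -ss' Ds' !size_cat /= !addnS addSn.
move=> w /hs'; rewrite Ds'; apply: alg_over_adj_trans => v.
rewrite !(mem_cat, inE) => /or4P[vt|va|/eqP ->|vb].
- by apply: alg_over_adj_mem; rewrite inE mem_cat vt orbT.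
- by apply: alg_over_adj_mem; rewrite inE !mem_cat va !orbT.
- apply: alg_over_adj_mono hx => u; rewrite !(mem_cat, inE).
  by case/or3P => ->; rewrite ?orbT.
- by apply: alg_over_adj_mem; rewrite inE !mem_cat vb !orbT.
Qed.

Lemma tower_indep_size S s t : tower_indep S t -> (forall x, x \in t -> alg_over (adj S s) x) ->
  (size t <= size s)%N.
Proof. by move=> it hs; have [s' [<- _]] := steinitz it hs; rewrite leq_addl. Qed.

Lemma exists_basis S s : exists h,
  [/\ subseq h s, tower_indep S h & forall x, x \in s -> alg_over (adj S h) x].
Proof.
elim: s => [|x s [h [hs ih hc]]]; first by exists [::].
case: (excluded_middle_informative (alg_over (adj S h) x)) => hx.
  exists h; split=> //; first exact: subseq_trans hs (subseq_cons _ _).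
  by move=> y; rewrite inE => /orP[/eqP -> //|]; apply: hc.
exists (x :: h); split=> //=; first by rewrite eqxx.
move=> y; rewrite inE => /orP[/eqP ->|/hc]; first by apply: alg_over_adj_mem; rewrite inE eqxx.
by apply: alg_over_adj_mono => w wh; rewrite inE wh orbT.
Qed.

(** A basis extracted from [s] is at least as long as [t] by exchange, so it is all of [s]. *)
Lemma tower_indep_of_size S s t : tower_indep S t -> (forall x, x \in t -> alg_over (adj S s) x) ->
  size t = size s -> tower_indep S s.
Proof.
move=> it hs st; have [h [hsub ih hc]] := exists_basis S s.
have th : (size t <= size h)%N.
  by apply: tower_indep_size it _ => x /hs; apply: alg_over_adj_trans.
by have /eqP <- : h == s by rewrite -size_subseq_leqif // eqn_leq size_subseq // -st.
Qed.

(** Each entry [y] is transcendental over [adj L h] for the entries [h] after it, so the results on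
    one transcendental element apply to [adj K h] inside [adj L h]; [lin_disj_tower] composes the
    disjointness. *)
Lemma tower_regular_lin_disj K L h : [pchar E] =i pred0 ->
  {subset K <= L} -> regular_in K L -> tower_indep L h ->
  regular_in (adj K h) (adj L h) /\
  lin_disj K (fun x => x \in L) (fun x => x \in adj K h).
Proof.
move=> ch0 KL reg; elim: h => [_|y h IH /= [ny ih]].
  have adj0 S x : x \in adj S [::] -> x \in S by apply: adj_min.
  split=> [x /adj0 xL algx|s c u cL uK indc rel k].
    apply/adj_base/reg => //; apply: alg_over_mono algx; exact: adj0.
  apply: (indc u) => [l|]; first exact/adj0/uK.
  by rewrite -[RHS]rel; apply: eq_bigr => l _; rewrite mulrC.
have [regh ldh] := IH ih.
have KLh : {subset adj K h <= adj L h} by apply: adj_mono.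
split=> [x xL algx|].
  apply: adj_cons_sup; apply: (regular_adj_transcendental ch0 KLh regh ny).
    exact: adj_cons_sub.
  by apply: alg_over_mono algx; apply: adj_cons_sub.
apply: (lin_disj_sub (A := fun x => x \in L) (B := fun x => x \in adj (adj K h) [:: y])) => //.
  by move=> x; apply: adj_cons_sub.
apply: lin_disj_tower ldh (lin_disj_adj_transcendental KLh ny) => // x.
exact: adj_base.
Qed.

Lemma ev_comp K z (p q : {poly sub_field K}) : ev K (ev K z q) p = ev K z (p \Po q).
Proof. by rewrite !evE map_comp_poly horner_comp. Qed.

(** Induction with the primitive element theorem for two elements: [x] and the previous [z] are
    polynomials in [z *+ n - x], and the earlier entries follow by composition. *)
Lemma primitive_element K s : [pchar E] =i pred0 ->
  (forall x, x \in s -> alg_over K x) ->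
  exists z, alg_over K z /\ forall x, x \in s -> exists p : {poly sub_field K}, x = ev _ z p.
Proof.
move=> ch0; elim: s => [_|x s IH hs].
  by exists 0; split=> //; apply: alg_over_base; exact: rpred0.
have [|z [algz hz]] := IH; first by move=> y ys; apply: hs; rewrite inE ys orbT.
have [p p0 rp] : alg_over K x by apply: hs; rewrite inE eqxx.
have [q q0 rq] := algz.
have chK : [pchar (sub_field K)] =i pred0 by move=> k; rewrite -(fmorph_pchar (sval_of K)) ch0.
have [n [[p1 Dx] [q1 Dz]]] := pchar0_PET p0 rp q0 rq chK.
exists (z *+ n - x); split.
  apply: algebraic_sub; last by exists p.
  elim: n {Dx Dz} => [|n IHn]; first exact: algebraic0.
  by rewrite mulrS; apply: algebraic_add.
move=> y; rewrite inE => /orP[/eqP ->|/hz[r ->]]; first by exists p1; rewrite evE Dx.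
by exists (r \Po q1); rewrite -ev_comp (evE _ q1) Dz.
Qed.

Lemma lin_disj_adj_algebraic K L z : {subset K <= L} -> regular_in K L -> alg_over K z ->
  lin_disj K (fun x => x \in L) (fun x => exists p : {poly sub_field K}, x = ev _ z p).
Proof.
move=> KL reg algz s c u cL uK indc rel k.
have [q Dq] := fin_all_exists uK.
rewrite Dq; apply: (@lin_disj_algebraic _ _ _ (incl KL) (sval_of L) z s
  (fun k => SubField (cL k)) q (regular_alg_closed reg) algz).
- move=> a rela l; apply: val_inj; apply: (indc (fun k => val (a k))) => [m|]; first exact: valP.
  have := congr1 val rela; rewrite rmorph_sum => E0; rewrite -[RHS]E0; apply: eq_bigr => m _.
  by rewrite rmorphM.
by rewrite -[RHS]rel; apply: eq_bigr => m _; rewrite [in RHS]Dq.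
Qed.

(** The polynomials in [z] over [adj K h] form a ring containing [s], so the disjointness covers all
    polynomial expressions in [s] over K. *)
Lemma lin_disj_gen K L s h : [pchar E] =i pred0 ->
  {subset K <= L} -> regular_in K L -> tower_indep L h ->
  (forall x, x \in s -> alg_over (adj K h) x) ->
  exists z, (forall x, x \in s -> exists p : {poly sub_field (adj K h)}, x = ev _ z p) /\
   lin_disj K (fun x => x \in L) (fun x => exists p : {poly sub_field (adj K h)}, x = ev _ z p).
Proof.
move=> ch0 KL reg ih algs.
have [regh ldh] := tower_regular_lin_disj ch0 KL reg ih.
have [z [algz hz]] := primitive_element ch0 algs.
exists z; split=> //.
have KLh : {subset adj K h <= adj L h} by apply: adj_mono.
apply: lin_disj_tower ldh (lin_disj_adj_algebraic KLh regh algz) => // x.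
exact: adj_base.
Qed.

End Dependence.

(** * Polynomials in several variables and algebraic independence *)

Lemma eq_mmap n (R S : nzRingType) (f g : R -> S) (h k : 'I_n -> S) :
  f =1 g -> h =1 k -> mmap f h =1 mmap g k.
Proof.
move=> fg hk p; apply: eq_bigr => m _; rewrite fg; congr (_ * _).
by apply: eq_bigr => i _; rewrite hk.
Qed.

(** Used with [eq_mmap] to prove two morphisms equal by comparing them on constants and
    variables. *)
Lemma rmorph_mpolyE n (R : nzRingType) (S : comNzRingType)
    (e : {rmorphism {mpoly R[n]} -> S}) p :
  e p = mmap (fun c => e c%:MP) (fun i => e 'X_i) p.
Proof.
rewrite {1}[p]mpolyE rmorph_sum; apply: eq_bigr => m _.
rewrite -mul_mpolyC rmorphM mpolyXE_id rmorph_prod; congr (_ * _).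
by apply: eq_bigr => i _; rewrite rmorphXn.
Qed.

Section LastVariable.
Variables (n : nat) (R : comNzRingType).
Local Notation widen := (widen_ord (leqnSn n)).

Lemma muniX_widen (i : 'I_n) : muni ('X_(widen i) : {mpoly R[n.+1]}) = ('X_i)%:P.
Proof.
rewrite /muni mmapX mmap1U; case: splitP => [j /= eqj|j /= eqj].
  by congr ('X__)%:P; apply: val_inj.
by have := ltn_ord i; rewrite eqj ltnNge leq_addr.
Qed.

Lemma muniX_max : muni ('X_ord_max : {mpoly R[n.+1]}) = 'X.
Proof.
rewrite /muni mmapX mmap1U; case: splitP => // j /= eqj.
by have := ltn_ord j; rewrite -eqj ltnn.
Qed.

Definition unmuni : {rmorphism {poly {mpoly R[n]}} -> {mpoly R[n.+1]}} :=
  horner_eval 'X_ord_max \o map_poly (@mwiden n R).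

Lemma mwidenX1 (i : 'I_n) : mwiden ('X_i : {mpoly R[n]}) = 'X_(widen i).
Proof. by rewrite mwidenX mnmwiden1. Qed.

Lemma ord_max_or_widen (i : 'I_n.+1) : i = ord_max \/ exists j, i = widen j.
Proof.
have [j eqj|j eqj] := splitP (cast_ord (esym (addn1 n)) i).
  by right; exists j; apply: val_inj.
by left; apply: val_inj; rewrite /= in eqj *; rewrite eqj ord1 addn0.
Qed.

Lemma muniK : cancel (@muni n R) unmuni.
Proof.
move=> p; change ((unmuni \o @muni n R) p = (idfun : {rmorphism _ -> _}) p).
rewrite !rmorph_mpolyE; apply: eq_mmap => [c|i] /=.
  by rewrite muniC /= map_polyC /horner_eval hornerC /= mwidenC.
case: (ord_max_or_widen i) => [->|[j ->]].
  by rewrite muniX_max map_polyX /horner_eval hornerX.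
by rewrite muniX_widen map_polyC /horner_eval hornerC /= mwidenX1.
Qed.

Lemma muni_mwiden (p : {mpoly R[n]}) : muni (mwiden p) = p%:P.
Proof.
change ((@muni n R \o @mwiden n R) p = polyC p).
rewrite !rmorph_mpolyE; apply: eq_mmap => [c|i] /=.
  by rewrite mwidenC muniC.
by rewrite mwidenX1 muniX_widen.
Qed.

Lemma unmuniK : cancel unmuni (@muni n R).
Proof.
move=> p; rewrite /= /horner_eval -horner_map /= muniX_max -map_poly_comp.
rewrite -[RHS]comp_polyXr; congr (_.['X]); apply: eq_map_poly => q.
exact: muni_mwiden.
Qed.

(** Isolates the last coordinate of the point, for the induction in [alg_indep_tower_indep]. *)
Lemma mmap_muni (S : comNzRingType) (f : {rmorphism R -> S}) (z : 'I_n.+1 -> S) p :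
  mmap f z p = (map_poly (mmap f (z \o widen)) (muni p)).[z ord_max].
Proof.
pose e := horner_eval (z ord_max) \o map_poly (mmap f (z \o widen)) \o @muni n R.
change (mmap f z p = (e : {rmorphism _ -> _}) p).
rewrite [RHS]rmorph_mpolyE; apply: eq_mmap => [c|i] /=.
  by rewrite muniC map_polyC /horner_eval hornerC /= mmapC.
case: (ord_max_or_widen i) => [->|[j ->]].
  by rewrite muniX_max map_polyX /horner_eval hornerX.
by rewrite muniX_widen map_polyC /horner_eval hornerC /= mmapX mmap1U.
Qed.

Lemma mmap_mwiden (S : comNzRingType) (f : {rmorphism R -> S}) (z : 'I_n.+1 -> S) p :
  mmap f z (mwiden p) = mmap f (z \o widen) p.
Proof. by rewrite mmap_muni muni_mwiden map_polyC hornerC. Qed.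

End LastVariable.

Section Image.
Variables (F E : fieldType) (phi : {rmorphism F -> E}).

Definition im_field : divringClosed E := gen (fun x => exists a, x = phi a).

Lemma im_fieldP x : x \in im_field <-> exists a, x = phi a.
Proof.
split; last exact: mem_gen.
apply: (gen_min (S := fun x => exists a, x = phi a)) => //; split; first by exists 1; rewrite rmorph1.
  by move=> _ _ [a ->] [b ->]; exists (a - b); rewrite rmorphB.
by move=> _ _ [a ->] [b ->]; exists (a / b); rewrite fmorph_div.
Qed.

Lemma alg_over_im_field x : alg_over im_field x -> algebraicOver phi x.
Proof.
move=> [q q0 rq].
have h k : exists a, val q`_k = phi a by apply/im_fieldP; exact: valP.
pose b k := proj1_sig (constructive_indefinite_description _ (h k)).
have Db k : val q`_k = phi (b k) := proj2_sig (constructive_indefinite_description _ (h k)).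
have Dq : map_poly phi (\poly_(k < size q) b k) = map_poly (sval_of im_field) q.
  apply/polyP => k; rewrite !coef_map coef_poly; case: ltnP => hk; first by rewrite /= Db.
  by rewrite (nth_default _ hk) /= !rmorph0.
exists (\poly_(k < size q) b k); last by rewrite Dq.
by rewrite -(map_poly_eq0 phi) Dq map_poly_eq0.
Qed.

Lemma mmap_in_adj n (z : 'I_n -> E) s p : (forall i, z i \in s) ->
  mmap phi z p \in adj im_field s.
Proof.
move=> zs; rewrite rpred_sum // => m _; apply: rpredM.
  by apply: adj_base; apply/im_fieldP; eexists.
by apply: rpred_prod => i _; apply: rpredX; apply: adj_mem.
Qed.

Lemma in_gen_field_adj n (z : 'I_n -> E) s w : (forall i, z i \in s) ->
  in_gen_field phi z w -> w \in adj im_field s.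
Proof. by move=> zs [f [g [_ ->]]]; rewrite rpred_div // mmap_in_adj. Qed.

Lemma adj_is_frac n (z : 'I_n -> E) s w : (forall x, x \in s -> exists i, x = z i) ->
  w \in adj im_field s -> is_frac (mmap phi z) w.
Proof.
move=> zs; apply: gen_min (subfield_pred_frac _) _ => y [/im_fieldP[a ->]|/zs[i ->]].
  by exists a%:MP, 1; rewrite rmorph1 /= mmapC divr1 oner_neq0.
by exists 'X_i, 1; rewrite rmorph1 /= mmapX mmap1U divr1 oner_neq0.
Qed.

(* Reversed because [muni] singles out the last variable. *)
Fixpoint rev_codom n : ('I_n -> E) -> seq E :=
  if n is m.+1 then fun z => z ord_max :: rev_codom (z \o widen_ord (leqnSn m))
  else fun _ => [::].

Lemma size_rev_codom n (z : 'I_n -> E) : size (rev_codom z) = n.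
Proof. by elim: n z => //= n IH z; rewrite IH. Qed.

Lemma rev_codomP n (z : 'I_n -> E) x : x \in rev_codom z <-> exists i, x = z i.
Proof.
elim: n z x => [|n IH] z x /=; first by split=> // -[[]].
rewrite inE; split=> [/orP[/eqP ->|/IH[i ->]]|[i ->]]; try by eexists.
case: (ord_max_or_widen i) => [->|[j ->]]; first by rewrite eqxx.
by apply/orP; right; apply/IH; exists j.
Qed.

Lemma exists_rev_codom s : exists z : 'I_(size s) -> E, rev_codom z = s.
Proof.
elim: s => [|x s [z Dz]] /=; first by exists (fun _ => 0).
(* [insub] fails exactly at the last index, which must carry the head of the list. *)
exists (fun i => if insub (val i) is Some j then z j else x).
rewrite insubF ?ltnn //; congr (_ :: _); rewrite -[RHS]Dz; congr rev_codom.
by apply: functional_extensionality => i /=; rewrite valK.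
Qed.

(** Induction through [muni]: a polynomial relation is an equation of the last coordinate with
    coefficients in the field of the others, and conversely an equation over that field becomes a
    polynomial relation once its denominators are cleared. *)
Lemma alg_indep_tower_indep n (z : 'I_n -> E) :
  alg_indep phi z <-> tower_indep im_field (rev_codom z).
Proof.
elim: n z => [|n IH] z /=.
  split=> // _ f; rewrite [f](nvar0_mpolyC f) /= mmapC => /eqP.
  by rewrite fmorph_eq0 => /eqP ->; rewrite mpolyC0.
set z' := z \o _; split=> [ind|[ntr it] f].
  split; last first.
    apply: (proj1 (IH z')) => f; rewrite -mmap_mwiden => h; have f0 := ind _ h.
    by apply: (@inj_mwiden n F); rewrite f0 rmorph0.
  move=> /(alg_over_clear (fun w => adj_is_frac (fun x => proj1 (rev_codomP z' x)))).
  case=> Q [l Ql] rel; case/negP: Ql.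
  suff -> : Q = 0 by rewrite coef0 rmorph0.
  apply: (can_inj (@unmuniK n F)); rewrite rmorph0; apply: ind.
  rewrite mmap_muni unmuniK (@horner_coef_wide _ (size Q)) ?size_poly // -[RHS]rel.
  by apply: eq_bigr => k _; rewrite coef_map.
have {}it := proj2 (IH z') it.
rewrite mmap_muni -/z' => rf.
suff f0 : muni f = 0 by rewrite -[f]muniK f0 rmorph0.
apply/polyP => l; rewrite coef0; apply: it; apply/eqP/negPn/negP => fl; apply: ntr.
set q := map_poly _ _ in rf.
have qT k : q`_k \in adj im_field (rev_codom z').
  by rewrite coef_map; apply: mmap_in_adj => i; apply/rev_codomP; exists i.
have Dq : map_poly (sval_of _) (\poly_(k < size q) SubField (qT k)) = q.
  apply/polyP => k; rewrite coef_map coef_poly; case: ltnP => // h.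
  by rewrite (nth_default _ h); exact: (rmorph0 (sval_of _)).
exists (\poly_(k < size q) SubField (qT k)); last by rewrite Dq; apply/eqP.
rewrite -(map_poly_eq0 (sval_of _)) Dq; apply: contraNneq fl => q0.
by rewrite -(coef_map (mmap phi z')) -/q q0 coef0.
Qed.

End Image.

(** * Linear disjointness of the values at H *)

Lemma mem_im_field (F E : fieldType) (phi : {rmorphism F -> E}) a : phi a \in im_field phi.
Proof. by apply/im_fieldP; exists a. Qed.

Lemma rmorph_mmap n (R : nzRingType) (S T : comNzRingType) (e : {rmorphism S -> T})
    (f : R -> S) (h : 'I_n -> S) p :
  e (mmap f h p) = mmap (e \o f) (e \o h) p.
Proof.
rewrite rmorph_sum; apply: eq_bigr => m _; rewrite rmorphM rmorph_prod; congr (_ * _).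
by apply: eq_bigr => i _; rewrite rmorphXn.
Qed.

Lemma in_gen_field_var (F E : fieldType) (phi : {rmorphism F -> E}) k (z : 'I_k -> E) j :
  in_gen_field phi z (z j).
Proof. by exists 'X_j, 1; rewrite rmorph1 /= mmapX mmap1U divr1 oner_neq0. Qed.

Section Values.
Variables (K L : fieldType) (iK : {rmorphism K -> L}) (n m : nat) (H : 'I_m -> {mpoly L[n]}).
Hypothesis ch0 : [pchar K] =i pred0.
Hypothesis clK : alg_closed_in iK.
Hypothesis trdegH : trdeg_le (fun c : K => tofrac (iK c)%:MP) (fun i => tofrac (H i))
           (fun c : L => tofrac c%:MP) (fun i => tofrac (H i)).

Let jL : {rmorphism L -> ratfun L n} := @tofrac _ \o @mpolyC n L.
Let jK : {rmorphism K -> ratfun L n} := jL \o iK.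
Let zH i := tofrac (H i).

Lemma subset_im_field : {subset im_field jK <= im_field jL}.
Proof. by move=> x /im_fieldP[a ->]; exact: mem_im_field. Qed.

Lemma regular_im_field : regular_in (im_field jK) (im_field jL).
Proof.
move=> x /im_fieldP[a ->] /alg_over_im_field[q q0 rq].
have [|c ->] := clK (a := a); last exact: (mem_im_field jK).
exists q => //; rewrite -(fmorph_root jL) -map_poly_comp; exact: rq.
Qed.

(** A basis [h] of K(H) over K bounds the first transcendence degree from below, so the hypothesis
    gives [size h] elements of L(H) independent over L. They are algebraic over L(h), and by
    exchange [h] is itself independent over L. *)
Lemma exists_common_basis : exists h, tower_indep (im_field jL) h /\
  forall x, x \in codom zH -> alg_over (adj (im_field jK) h) x.
Proof.
have [h [hsub ih hc]] := exists_basis (im_field jK) (codom zH).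
exists h; split=> //.
have [z Dz] := exists_rev_codom h.
have indz : alg_indep jK z by apply/alg_indep_tower_indep; rewrite Dz.
have [|w [wH indw]] := trdegH (k := size h).
  exists z; split=> // i.
  have : z i \in codom zH.
    by apply: (mem_subseq hsub); rewrite -Dz; apply/rev_codomP; exists i.
  by move=> /codomP[j ->]; exact: (in_gen_field_var jK).
have {}indw := proj1 (alg_indep_tower_indep jL w) indw.
apply: tower_indep_of_size indw _ _; last exact: size_rev_codom.
move=> x /rev_codomP[i ->].
have wi : w i \in adj (im_field jL) (codom zH).
  by apply: (@in_gen_field_adj _ _ jL m zH _ _ _ (wH i)) => j; exact: codom_f.
apply: (@alg_over_adj _ (im_field jL) (codom zH)) (alg_over_base wi).
  by move=> y; apply: adj_base.
move=> y /hc; apply: alg_over_mono; apply: adj_mono => //; exact: subset_im_field.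
Qed.

(** In the fraction field the components of H are polynomials in a primitive element [z], hence so
    are the values at H of polynomials over K, and [lin_disj_gen] applies. *)
Lemma values_lin_disj s (c : 'I_s -> L) (g : 'I_s -> {mpoly K[m]}) :
  (forall a : 'I_s -> K, \sum_k iK (a k) * c k = 0 -> forall k, a k = 0) ->
  \sum_k (c k)%:MP * mmap (@mpolyC n L \o iK) H (g k) = 0 ->
  forall k, mmap (@mpolyC n L \o iK) H (g k) = 0.
Proof.
move=> indc rel k; have [h [ih hc]] := exists_common_basis.
have chE : [pchar (ratfun L n)] =i pred0 by move=> x; rewrite (fmorph_pchar jK) ch0.
have [z [hz ld]] := lin_disj_gen chE subset_im_field regular_im_field ih hc.
apply/eqP; rewrite -tofrac_eq0; apply/eqP.
apply: (ld s (fun k => jL (c k)) (fun k => tofrac (mmap (@mpolyC n L \o iK) H (g k)))).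
- by move=> l; exact: mem_im_field.
- move=> l; rewrite (rmorph_mmap (@tofrac _)) /mmap.
  apply: (big_ind (fun x => exists p : {poly sub_field (adj (im_field jK) h)},
    x = ev _ z p)) => [|_ _ [p1 ->] [p2 ->]|mm _]; first by exists 0; rewrite rmorph0.
    by exists (p1 + p2); rewrite rmorphD.
  have hp : forall i, exists p, zH i = ev (adj (im_field jK) h) z p.
    by move=> i; apply: hz; exact: codom_f.
  have [p Dp] := fin_all_exists hp.
  have aK : jK (g l)@_mm \in adj (im_field jK) h by apply/adj_base/mem_im_field.
  exists ((SubField aK)%:P * \prod_i p i ^+ mm i).
  rewrite rmorphM rmorph_prod evE (map_polyC (sval_of _)) hornerC; congr (_ * _).
  by apply: eq_bigr => i _; rewrite rmorphXn -Dp.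
- move=> a aK rela.
  have hb l : exists b, a l = jK b by apply/im_fieldP.
  have [b Db] := fin_all_exists hb.
  move=> l; rewrite Db (indc b) ?rmorph0 //; apply: (fmorph_inj jL).
  rewrite rmorph0 rmorph_sum -[RHS]rela; apply: eq_bigr => i _.
  by rewrite rmorphM Db.
by rewrite -[RHS](rmorph0 (@tofrac _)) -rel rmorph_sum; apply: eq_bigr => i _; rewrite rmorphM.
Qed.

End Values.

Section Extension.
Variables (K L Lt : fieldType) (iK : {rmorphism K -> L}) (iL : {rmorphism L -> Lt}).
Variables (n m : nat) (H : 'I_m -> {mpoly L[n]}).
Hypothesis ch0 : [pchar K] =i pred0.
Hypothesis clK : alg_closed_in iK.
Hypothesis trdegH : trdeg_le (fun c : K => tofrac (iK c)%:MP) (fun i => tofrac (H i))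
           (fun c : L => tofrac c%:MP) (fun i => tofrac (H i)).

Let jT : {rmorphism Lt -> ratfun Lt n} := @tofrac _ \o @mpolyC n Lt.
Let jL : {rmorphism L -> ratfun Lt n} := jT \o iL.
Let jK : {rmorphism K -> ratfun Lt n} := jL \o iK.
Let valH : {rmorphism {mpoly K[m]} -> {mpoly L[n]}} := mmap (@mpolyC n L \o iK) H.
Let emb : {rmorphism {mpoly L[n]} -> ratfun Lt n} := @tofrac _ \o map_mpoly iL.

Lemma emb_inj : injective emb.
Proof.
move=> p q /eqP; rewrite /= tofrac_eq => /eqP pq; apply/mpolyP => k.
by apply: (fmorph_inj iL); rewrite -!mcoeff_map_mpoly pq.
Qed.

Lemma embC a : emb a%:MP = jL a.
Proof. by rewrite /= map_mpolyC. Qed.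

(** L and K[H] are disjoint over K, [Lt] and L[x] over L. For [lin_disj_tower] the intermediate
    field L has to stand in second position, so both are swapped, composed and swapped back. *)
Lemma lin_disj_values : lin_disj (im_field jK)
  (fun x => exists a, x = jT a) (fun x => exists g, x = emb (valH g)).
Proof.
have D1 : lin_disj (im_field jK) (fun x => x \in im_field jL)
    (fun x => exists g, x = emb (valH g)).
  move=> s c u cL uH indc rel.
  have hb l : exists b, c l = jL b by apply/im_fieldP.
  have [b Db] := fin_all_exists hb.
  have [g Dg] := fin_all_exists uH.
  move=> k; rewrite Dg.
  have -> // : valH (g k) = 0; last by rewrite rmorph0.
  apply: (values_lin_disj ch0 clK trdegH (c := b)) => [a rela l|].
    apply: (fmorph_inj jK); rewrite rmorph0; apply: (indc (fun l => jK (a l))) => [i|].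
      exact: mem_im_field.
    rewrite -[RHS](rmorph0 jL) -rela rmorph_sum; apply: eq_bigr => i _.
    by rewrite Db rmorphM.
  apply: emb_inj; rewrite rmorph0 -[RHS]rel rmorph_sum; apply: eq_bigr => i _.
  by rewrite rmorphM embC Db Dg.
(* Each monomial of L[x] contributes a relation of the [c l] over L. *)
have D2 : lin_disj (im_field jL) (fun x => exists a, x = jT a)
    (fun x => exists q, x = emb q).
  move=> s c u cL uH indc rel.
  have [b Db] := fin_all_exists cL.
  have [g Dg] := fin_all_exists uH.
  move=> k; rewrite Dg; have -> : g k = 0; last by rewrite rmorph0.
  apply/mpolyP => mm; rewrite mcoeff0; apply: (fmorph_inj jL); rewrite rmorph0.
  apply: (indc (fun l => jL (g l)@_mm)) => [i|]; first exact: mem_im_field.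
  have rel' : \sum_l (b l)%:MP * map_mpoly iL (g l) = 0.
    apply/eqP; rewrite -tofrac_eq0 rmorph_sum; apply/eqP; rewrite -[RHS]rel.
    by apply: eq_bigr => i _; rewrite rmorphM Db Dg.
  have := congr1 (mcoeff mm) rel'; rewrite raddf_sum mcoeff0 => rel2.
  rewrite -[RHS](rmorph0 jT) -rel2 rmorph_sum; apply: eq_bigr => i _.
  have bg : ((b i)%:MP * map_mpoly iL (g i))@_mm = b i * iL (g i)@_mm.
    by rewrite mul_mpolyC mcoeffZ mcoeff_map_mpoly.
  transitivity (jT (b i * iL (g i)@_mm)); last by congr (jT _); exact/esym/bg.
  by rewrite (rmorphM jT) mulrC -Db.
have D1' := lin_disj_sym _ D1; have D2' := lin_disj_sym _ D2.
apply: lin_disj_sym.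
  move=> _ _ _ /im_fieldP[d ->] [a ->] [b ->]; exists (a - iL (iK d) * b).
  by rewrite rmorphB rmorphM.
apply: lin_disj_tower (D1' _) (D2' _) => [x /im_fieldP[a ->]|_ [g ->]
  |_ _ _ /im_fieldP[d ->] [a ->] [b ->]|_ _ _ /im_fieldP[d ->] [a ->] [b ->]].
- exact: mem_im_field.
- by exists (valH g).
- exists (a - (d%:MP) * b); rewrite rmorphB rmorphB rmorphM rmorphM.
  by rewrite [valH d%:MP]mmapC embC.
by exists (a - d%:MP * b); rewrite rmorphB rmorphM embC.
Qed.

Lemma extension_values_lin_disj s (c : 'I_s -> Lt) (g : 'I_s -> {mpoly K[m]}) :
  (forall a : 'I_s -> K, \sum_k iL (iK (a k)) * c k = 0 -> forall k, a k = 0) ->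
  \sum_k (c k)%:MP * map_mpoly iL (valH (g k)) = 0 ->
  forall k, map_mpoly iL (valH (g k)) = 0.
Proof.
move=> indc rel k; apply/eqP; rewrite -tofrac_eq0; apply/eqP.
apply: (lin_disj_values (c := fun k => jT (c k)) (u := fun k => emb (valH (g k)))).
- by move=> l; exists (c l).
- by move=> l; exists (g l).
- move=> a aK rela.
  have hb l : exists b, a l = jK b by apply/im_fieldP.
  have [b Db] := fin_all_exists hb.
  move=> l; rewrite Db (indc b) ?rmorph0 //; apply: (fmorph_inj jT).
  rewrite rmorph0 rmorph_sum -[RHS]rela; apply: eq_bigr => i _.
  by rewrite rmorphM Db.
by rewrite -[RHS](rmorph0 (@tofrac _)) -rel rmorph_sum; apply: eq_bigr => i _; rewrite rmorphM.
Qed.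

End Extension.

(** * Directional derivatives and the image apex *)

Lemma mpoly_ring_ind n (R : nzRingType) (P : {mpoly R[n]} -> Prop) :
  (forall c, P c%:MP) -> (forall i, P 'X_i) ->
  (forall p q, P p -> P q -> P (p + q)) -> (forall p q, P p -> P q -> P (p * q)) ->
  forall p, P p.
Proof.
move=> PC PX PD PM p; rewrite [p]mpolyE.
apply: big_ind => [|//|mm _]; first by rewrite -mpolyC0; apply: PC.
rewrite -mul_mpolyC mpolyXE_id; apply: (PM) => //.
apply: big_ind => [|//|i _]; first by rewrite -mpolyC1; apply: PC.
by elim: (mm i) => [|k IH]; rewrite ?expr0 -?mpolyC1 // exprS; apply: PM.
Qed.

(** Starting from the expansion in monomials, a coefficient that depends on the others over F is
    eliminated, which shortens the sum. *)
Lemma mpoly_indep_decomposition (F E : fieldType) (phi : {rmorphism F -> E}) n (f : {mpoly E[n]}) :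
  exists s (c : 'I_s -> E) (g : 'I_s -> {mpoly F[n]}),
    (forall a : 'I_s -> F, \sum_k phi (a k) * c k = 0 -> forall k, a k = 0) /\
    f = \sum_k (c k)%:MP * map_mpoly phi (g k).
Proof.
have : exists s (c : 'I_s -> E) (g : 'I_s -> {mpoly F[n]}),
    f = \sum_k (c k)%:MP * map_mpoly phi (g k).
  exists (size (msupp f)), (fun k => f@_(nth 0%MM (msupp f) k)),
    (fun k => 'X_[nth 0%MM (msupp f) k]).
  rewrite {1}[f]mpolyE (big_nth 0%MM) big_mkord; apply: eq_bigr => k _.
  by rewrite map_mpolyX mul_mpolyC.
case=> s; elim: s => [|s IH] [c [g Df]].
  by exists 0%N, c, g; split=> // a _ [].
case: (excluded_middle_informative (forall a : 'I_s.+1 -> F,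
    \sum_k phi (a k) * c k = 0 -> forall k, a k = 0)) => [ind|nind].
  by exists s.+1, c, g.
have [a [rela [k ak]]] : exists a : 'I_s.+1 -> F,
    \sum_k phi (a k) * c k = 0 /\ exists k, a k != 0.
  apply: NNPP => h; apply: nind => a ra k; apply/eqP/negPn/negP => ak.
  by apply: h; exists a; split=> //; exists k.
pose b l := a (lift k l) / a k.
have pak : phi (a k) != 0 by rewrite fmorph_eq0.
have ck : c k = - \sum_l phi (b l) * c (lift k l).
  move: rela; rewrite (bigD1_ord k) //= => /eqP; rewrite addr_eq0 => /eqP rela.
  apply: (mulfI pak); rewrite rela mulrN mulr_sumr; congr (- _); apply: eq_bigr => l _.
  by rewrite /b fmorph_div; field.
apply: IH; exists (fun l => c (lift k l)), (fun l => g (lift k l) - (b l)%:MP * g k).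
rewrite Df (bigD1_ord k) //= ck mpolyCN raddf_sum /= mulNr mulr_suml addrC -sumrB.
apply: eq_bigr => l _.
have -> : map_mpoly phi (g (lift k l) - (b l)%:MP * g k)
    = map_mpoly phi (g (lift k l)) - (phi (b l))%:MP * map_mpoly phi (g k).
  by rewrite rmorphB rmorphM /= map_mpolyC.
rewrite mpolyCM; ring.
Qed.

Section Shift.
Variables (F E : fieldType) (phi : {rmorphism F -> E}) (n m : nat).
Variables (H : 'I_m -> {mpoly E[n]}) (v : 'I_m -> E).

(** Spelled with the same functions as in [proj_apex] so as to be convertible with it; the outer
    ['X] is the indeterminate t. *)
Definition shift_mmap : {mpoly F[m]} -> {poly {mpoly E[n]}} :=
  mmap (fun c => ((phi c)%:MP)%:P) (fun i => (H i)%:P + 'X * ((v i)%:MP)%:P).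

Lemma shift_mmap_morphism : exists e : {rmorphism {mpoly F[m]} -> {poly {mpoly E[n]}}},
  [/\ shift_mmap =1 e, forall c, e c%:MP = ((phi c)%:MP)%:P &
      forall i, e 'X_i = (H i)%:P + 'X * ((v i)%:MP)%:P].
Proof.
exists (mmap (@polyC _ \o @mpolyC n E \o phi) (fun i => (H i)%:P + 'X * ((v i)%:MP)%:P)).
by split=> [f|c|i] //=; rewrite ?mmapC // mmapX mmap1U.
Qed.

(** The chain rule in t, checked on constants and variables: both sides are additive and obey the
    Leibniz rule. *)
Lemma deriv_shift f : (shift_mmap f)^`() = \sum_i ((v i)%:MP)%:P * shift_mmap f^`M(i).
Proof.
have [e [De eC eX]] := shift_mmap_morphism.
rewrite De; under eq_bigr => i _ do rewrite De.
elim/mpoly_ring_ind: f => [c|j|p q Dp Dq|p q Dp Dq].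
- rewrite eC derivC big1 // => i _.
  by rewrite mderivC rmorph0 mulr0.
- rewrite eX derivD derivC add0r derivM derivX derivC mulr0 addr0 mul1r.
  rewrite (bigD1 j) //= mderivX big1 ?addr0 => [|i ij].
    by rewrite mnm1E eqxx scale1r (_ : (U_(j) - U_(j))%MM = 0%MM) ?mpolyX0 ?rmorph1 ?mulr1 //;
       apply/mnmP => i; rewrite mnmBE subnn mnm0E.
  by rewrite mderivX mnm1E eq_sym (negPf ij) scale0r rmorph0 mulr0.
- rewrite rmorphD derivD Dp Dq -big_split; apply: eq_bigr => i _ /=.
  by rewrite mderivD rmorphD mulrDr.
rewrite rmorphM derivM Dp Dq mulr_suml mulr_sumr -big_split; apply: eq_bigr => i _ /=.
by rewrite mderivM rmorphD !rmorphM; ring.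
Qed.

Lemma coef0_shift f : (shift_mmap f)`_0 = mmap (fun c => (phi c)%:MP) H f.
Proof.
rewrite -horner_coef0 -[_.[0]]/(horner_eval 0 (shift_mmap f)) /shift_mmap.
rewrite rmorph_mmap; apply: eq_mmap => [c|i] /=.
  by rewrite /horner_eval hornerC.
by rewrite /horner_eval hornerD hornerM hornerX mul0r hornerC addr0.
Qed.

End Shift.

(** Taylor's formula: k + 1 times the coefficient of t^(k+1) is the coefficient of t^k for the
    derivative of [f] along [v], which again vanishes at H by stability. *)
Lemma shift_eq0 (F E : fieldType) (phi : {rmorphism F -> E}) n m
    (H : 'I_m -> {mpoly E[n]}) (v : 'I_m -> F) (f : {mpoly F[m]}) :
  [pchar F] =i pred0 ->
  (forall g : {mpoly F[m]}, mmap (fun c => (phi c)%:MP) H g = 0 ->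
     mmap (fun c => (phi c)%:MP) H (\sum_i v i *: g^`M(i)) = 0) ->
  mmap (fun c => (phi c)%:MP) H f = 0 -> shift_mmap phi H (phi \o v) f = 0.
Proof.
move=> ch0 stab Hf; apply/polyP => k; rewrite coef0; elim: k f Hf => [|k IH] f Hf.
  by rewrite coef0_shift.
have := IH _ (stab f Hf).
have -> : shift_mmap phi H (phi \o v) (\sum_i v i *: f^`M(i)) = (shift_mmap phi H (phi \o v) f)^`().
  have [e [De eC _]] := shift_mmap_morphism phi H (phi \o v).
  rewrite deriv_shift De rmorph_sum; apply: eq_bigr => i _.
  by rewrite De -mul_mpolyC rmorphM eC.
rewrite coef_deriv => h.
have k0 : (k.+1%:R : F) != 0 by move/pcharf0P: ch0 => ->.
have : (phi k.+1%:R)%:MP * (shift_mmap phi H (phi \o v) f)`_k.+1 = 0.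
  by rewrite rmorph_nat rmorph_nat mulr_natl.
by move/eqP; rewrite mulf_eq0 mpolyC_eq0 fmorph_eq0 (negPf k0) => /eqP.
Qed.

Theorem theorem4p7 (K L Lt : fieldType)
  (iK : {rmorphism K -> L}) (iL : {rmorphism L -> Lt})
  (n m : nat) (H : 'I_m -> {mpoly L[n]}) (p : 'I_m -> Lt)
  (r : nat) (lam : 'I_r -> Lt) (P : 'I_r -> 'I_m -> K) :
  [pchar K] =i pred0 ->
  alg_closed_in iK ->
  trdeg_le (fun c : K => tofrac (iK c)%:MP) (fun i => tofrac (H i))
           (fun c : L => tofrac c%:MP) (fun i => tofrac (H i)) ->
  proj_apex (fun c : K => iL (iK c)) (fun i => map_mpoly iL (H i)) p ->
  (forall j, p j = \sum_(i < r) lam i * iL (iK (P i j))) ->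
  (forall c : 'I_r -> K, \sum_(i < r) iL (iK (c i)) * lam i = 0 ->
     forall i, c i = 0) ->
  forall i : 'I_r,
    (forall j, P i j = 0) \/
    proj_apex (fun c : Lt => c) (fun j => map_mpoly iL (H j))
              (fun j => iL (iK (P i j))).
Proof.
move=> ch0 clK trdegH [_ apex] Dp indl i.
pose phi : {rmorphism K -> Lt} := iL \o iK.
pose H' j := map_mpoly iL (H j).
pose evH : {rmorphism {mpoly K[m]} -> {mpoly Lt[n]}} := mmap (@mpolyC n Lt \o phi) H'.
have evHE g : evH g = map_mpoly iL (mmap (@mpolyC n L \o iK) H g).
  by rewrite rmorph_mmap; apply: eq_mmap => c //=; rewrite map_mpolyC.
have ld s (c : 'I_s -> Lt) (g : 'I_s -> {mpoly K[m]}) :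
  (forall a : 'I_s -> K, \sum_k iL (iK (a k)) * c k = 0 -> forall k, a k = 0) ->
  \sum_k (c k)%:MP * evH (g k) = 0 -> forall k, evH (g k) = 0.
  move=> indc rel k; rewrite evHE.
  apply: (extension_values_lin_disj ch0 clK trdegH indc) => //.
  by rewrite -[RHS]rel; apply: eq_bigr => l _; rewrite evHE.
have stab (f : {mpoly K[m]}) : evH f = 0 -> evH (\sum_j P i j *: f^`M(j)) = 0.
  (* The constant term of the t-derivative of f(H + tp) is a combination of the [lam k] with the
     values at H of the derivatives along [P k]; disjointness makes each value zero. *)
  move=> Hf; have /(congr1 (fun q : {poly _} => q^`()`_0)) := apex f Hf.
  rewrite deriv0 coef0 -[mmap _ _ f]/(shift_mmap phi H' p f) deriv_shift coef_sum => rel.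
  apply: (ld r lam (fun i => \sum_j P i j *: f^`M(j)) indl).
  rewrite -[RHS]rel; under eq_bigr => k _ do rewrite rmorph_sum mulr_sumr.
  rewrite exchange_big; apply: eq_bigr => j _ /=.
  rewrite coefCM coef0_shift -[mmap _ _ _]/(evH f^`M(j)) Dp raddf_sum /= mulr_suml.
  apply: eq_bigr => k _; rewrite -mul_mpolyC rmorphM [evH (P k j)%:MP]mmapC mpolyCM /=.
  by rewrite mulrA.
case: (excluded_middle_informative (forall j, P i j = 0)) => [|nz]; [by left | right].
split=> [|f].
  apply: NNPP => h; apply: nz => j; apply/eqP/negPn/negP => Pij.
  by apply: h; exists j; rewrite (fmorph_eq0 phi).
(* Stability concerns polynomials over K. With coefficients [c] independent over K, disjointness
   makes every [g k] vanish at H as soon as the sum does. *)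
have [s [c [g [indc ->]]]] := mpoly_indep_decomposition phi f.
(* [e0] and [e1] are the two evaluations in [proj_apex] over [Lt], as ring morphisms. *)
pose e0 : {rmorphism {mpoly Lt[m]} -> {mpoly Lt[n]}} := mmap (@mpolyC n Lt) H'.
pose e1 : {rmorphism {mpoly Lt[m]} -> {poly {mpoly Lt[n]}}} :=
  mmap (@polyC _ \o @mpolyC n Lt) (fun j => (H' j)%:P + 'X * ((phi (P i j))%:MP)%:P).
have e0E q : e0 (map_mpoly phi q) = evH q.
  rewrite -[e0 _]/((e0 \o map_mpoly phi) q) rmorph_mpolyE; apply: eq_mmap => [a|j] /=.
    by rewrite map_mpolyC mmapC.
  by rewrite map_mpolyX mmapX mmap1U.
have e1E q : e1 (map_mpoly phi q) = shift_mmap phi H' (phi \o P i) q.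
  rewrite -[e1 _]/((e1 \o map_mpoly phi) q) rmorph_mpolyE; apply: eq_mmap => [a|j] /=.
    by rewrite map_mpolyC mmapC.
  by rewrite map_mpolyX mmapX mmap1U.
rewrite -[mmap _ _ _]/(e0 _) rmorph_sum => rel.
rewrite -[LHS]/(e1 _) rmorph_sum big1 // => k _.
rewrite rmorphM e1E shift_eq0 ?mulr0 // -[LHS]/(evH (g k)).
apply: (ld s c g indc); rewrite -[RHS]rel; apply: eq_bigr => l _.
by rewrite rmorphM e0E [e0 _]mmapC.
Qed.
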